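(* Let $G$ be a finitely generated group and $H$ an infinite normal subgroup of $G$. Let $K$ be any finitely generated subgroup of $H$. Then $div(G,H)\preceq dist^K_G$. In particular, if $H$ is finitely generated, then $div(G,H)\preceq dist^H_G$.
   Context: Domination. For functions $f,g$ with values in $[0,\infty]$ of a nonnegative (or positive) real variable, $f\preceq g$ means there are $A,B,C>0$ with $f(x)\le g(Ax)+Bx$ for all $x>C$. For families indexed by $\rho\in(0,1]$ and integers $n\ge2$, $\{\sigma^n_\rho\}\preceq\{\sigma'^n_\rho\}$ means there are $L\in(0,1]$ and a positive integer $M$ with $\sigma^n_{L\rho}\preceq\sigma'^{Mn}_\rho$ for all $\rho,n$. A single function is regarded as a family constant in $\rho,n$. Lower relative divergence. For a finite generating set $S$ of $G$ and a subgroup $H$, work in the Cayley graph $X=\Gamma(G,S)$ with path metric $d$. Put $N_r(H)=\{x: d(x,H)<r\}$, $\partial N_r(H)=\{x:d(x,H)=r\}$, $C_r(H)=X-N_r(H)$, and let $d_r$ be the induced length metric on $C_r(H)$ ($\infty$ for points not joined by a path in $C_r(H)$). For $\rho\in(0,1]$ and integer $n\ge2$ let $\sigma^n_\rho(r)=\inf d_{\rho r}(x_1,x_2)$ over all $x_1,x_2\in\partial N_r(H)$ with $d_r(x_1,x_2)<\infty$ and $d(x_1,x_2)\ge nr$, with $\sigma^n_\rho(r)=\infty$ if there is no such pair. $div(G,H)$ is the family $\{\sigma^n_\rho\}$; up to mutual domination it does not depend on $S$. Lower distortion. For finite generating sets $S$ of $G$ and $T$ of a subgroup $K$, with corresponding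 word lengths $|\cdot|_S$ and $|\cdot|_T$, $dist^K_G(r)=\min\{|k|_T : k\in K,\ |k|_S\ge r\}$ for $r>0$ (minimum of the empty set is $0$); up to mutual domination it does not depend on $S,T$.
   Formalization: H is also assumed to have infinite index in G (for finite index the divergence is eventually infinite and the claim fails), and in the first claim K is assumed infinite (for finite K the lower distortion is eventually 0 and the claim can fail). *)

(* Defs.v *)
From HB Require Import structures.
From mathcomp Require Import all_boot all_order all_algebra.
From mathcomp Require Import all_classical all_reals all_analysis.

Set Implicit Arguments.
Unset Strict Implicit.
Unset Printing Implicit Defensive.

Import Order.TTheory GRing.Theory Num.Theory.

Local Open Scope classical_set_scope.
Local Open Scope ring_scope.

(** * Subgroups of a possibly infinite group *)

Section Groups.
Variable G : groupType.
Implicit Types (H K : set G) (S w : seq G).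

Definition subgroup H : Prop := group_closed [in H].

Definition normal_subgroup H : Prop :=
  subgroup H /\ forall h g : G, H h -> H (h ^ g)%g.

Definition left_coset (g : G) H : set G := [set (g * h)%g | h in H].

Definition infinite_index H : Prop :=
  infinite_set [set left_coset g H | g in [set: G]].

(** [w] is a word in the letters [S] and their inverses; the element it
    represents is [word_value w]. *)
Definition is_word S w : bool := all (fun x => (x \in S) || (x^-1%g \in S)) w.

Definition word_value w : G := (\prod_(x <- w) x)%g.

Definition subgroup_generated S : set G :=
  [set word_value w | w in [set w | is_word S w]].

(** The finite set underlying the list [S] generates the subgroup [K]. *)
Definition generates S K : Prop := subgroup_generated S = K.

(** Least element of a set of natural numbers; [0] for the empty set. *)
Definition min_nat (A : set nat) : nat :=
  xget 0%N [set n | A n /\ forall m, A m -> (n <= m)%N].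

Definition word_length S (g : G) : nat :=
  min_nat [set size w | w in [set w | is_word S w /\ word_value w = g]].

End Groups.

(** * Length metrics, for a space given by its distance function *)

Section LengthMetric.
Variables (R : realType) (X : Type) (d : X -> X -> \bar R).
Implicit Types (A C : set X) (gamma : R -> X).

Definition dist_to_set (x : X) A : \bar R := ereal_inf [set d x a | a in A].

Definition curve_continuous gamma : Prop :=
  forall t e : R, 0 <= t <= 1 -> 0 < e -> exists2 delta : R, 0 < delta &
    forall u : R, 0 <= u <= 1 -> `|u - t| < delta ->
      (d (gamma t) (gamma u) < e%:E)%E.

(** Length of [gamma : [0, 1] -> X]: supremum over the subdivisions
    [0 = s_0 < s_1 < ... < s_m = 1] of the sum of the [d (gamma s_i) (gamma s_i+1)];
    [itv_partition] lists the subdivision without its first point. *)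
Definition curve_length gamma : \bar R :=
  ereal_sup [set (\sum_(0 <= i < size s)
      d (gamma (nth 1%R (0%R :: s) i)) (gamma (nth 1%R (0%R :: s) i.+1)))%E
    | s in itv_partition (0 : R) 1].

(** [+oo] when no path of [C] joins [x] to [y]. *)
Definition length_metric C (x y : X) : \bar R :=
  ereal_inf [set curve_length gamma | gamma in
    [set gamma | [/\ curve_continuous gamma, gamma 0 = x, gamma 1 = y &
      forall t : R, 0 <= t <= 1 -> C (gamma t)]]].

End LengthMetric.

(** * The Cayley graph as a metric graph *)

Section CayleyGraph.
Variables (R : realType) (G : groupType) (S : seq G).

Definition open_unit : Type := {t : R | 0 < t < 1}.

(** Points of the geometric realization: the vertices are the elements of [G],
    and there is an edge of length [1] from [g] to [g * s] for each [g] in [G]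
    and each [s] in [S]. *)
Inductive cayley_point : Type :=
| Vertex of G
| Inner of G & seq_sub S & open_unit.

(** Point with parameter [t] in [[0, 1]] on the edge from [g] to [g * s]. *)
Definition edge_point (g : G) (s : seq_sub S) (t : R) : cayley_point :=
  if insub t is Some u then Inner g s u
  else if t <= 0 then Vertex g else Vertex (g * val s)%g.

(** Piecewise linear paths, each piece being a segment of one edge, together
    with their lengths. *)
Inductive pl_path : cayley_point -> cayley_point -> R -> Prop :=
| pl_refl x : pl_path x x 0
| pl_step g s (a b : R) y l :
    0 <= a <= 1 -> 0 <= b <= 1 -> pl_path (edge_point g s b) y l ->
    pl_path (edge_point g s a) y (`|a - b| + l).

Definition cayley_dist (x y : cayley_point) : \bar R :=
  ereal_inf [set l%:E | l in pl_path x y].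

Variable H : set G.

Definition dist_to_subgroup (x : cayley_point) : \bar R :=
  dist_to_set cayley_dist x (Vertex @` H).

Definition nbhd (r : R) : set cayley_point :=
  [set x | (dist_to_subgroup x < r%:E)%E].

Definition nbhd_boundary (r : R) : set cayley_point :=
  [set x | dist_to_subgroup x = r%:E].

Definition nbhd_compl (r : R) : set cayley_point := ~` nbhd r.

Definition compl_dist (r : R) : cayley_point -> cayley_point -> \bar R :=
  length_metric cayley_dist (nbhd_compl r).

(** The family [sigma^n_rho (r)] representing [div (G, H)]; the infimum of the
    empty set is [+oo]. *)
Definition lower_divergence (rho : R) (n : nat) (r : R) : \bar R :=
  ereal_inf [set compl_dist (rho * r) x.1 x.2 | x in
    [set x : cayley_point * cayley_point |
      [/\ nbhd_boundary r x.1, nbhd_boundary r x.2,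
          (compl_dist r x.1 x.2 < +oo)%E &
          ((n%:R * r)%:E <= cayley_dist x.1 x.2)%E]]].

End CayleyGraph.

(** [S] generates the ambient group, [T] generates the subgroup [K]. *)
Definition lower_distortion (R : realType) (G : groupType) (S T : seq G)
    (K : set G) (r : R) : \bar R :=
  (min_nat [set word_length T k | k in
    [set k | K k /\ r <= (word_length S k)%:R]])%:R%:E.

(** * Domination *)

Definition dominated (R : realType) (f g : R -> \bar R) : Prop :=
  exists A B C : R, [/\ 0 < A, 0 < B, 0 < C &
    forall x : R, C < x -> (f x <= g (A * x)%R + (B * x)%:E)%E].

Definition family_dominated (R : realType) (F F' : R -> nat -> R -> \bar R) :
    Prop :=
  exists (L : R) (M : nat), [/\ 0 < L <= 1, (0 < M)%N &
    forall (rho : R) (n : nat), 0 < rho <= 1 -> (2 <= n)%N ->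
      dominated (F (L * rho) n) (F' rho (M * n)%N)].

Definition const_family (R : realType) (f : R -> \bar R) :
    R -> nat -> R -> \bar R := fun _ _ => f.

(* Main.v *)
Require Import Defs.
From mathcomp Require Import all_boot all_order all_algebra.
From mathcomp Require Import all_classical all_reals all_analysis.
From mathcomp Require Import ring lra zify.

Set Implicit Arguments.
Unset Strict Implicit.
Unset Printing Implicit Defensive.

Import Order.TTheory GRing.Theory Num.Theory.

Local Open Scope classical_set_scope.

(** Write [|x]_S for word length. Since [H] is normal, [g * k] lies in the coset
    [H * g] for every [k] in [H], so right multiplication by elements of [H]
    keeps the distance to [H] constant ([set_dist_mulr]). Hence a word in the
    generators of [K] can be followed, letter by letter, starting at any vertex:
    each letter costs at most a constant [c], and the path never comes closer to
    [H] by more than [c] ([coset_arc]).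

    Given [r], infinite index provides a vertex [g] at distance between
    [r + c] and [r + c + 1] from [H]. For [k] in [K], go from the point [x1] at
    height [r] on a geodesic from [H] to [g] up to [g], follow a word for [k]
    to [g * k], and come down to the point [x2] at height [r] below [g * k]
    ([radial_arc]). This path stays outside the [r]-neighbourhood of [H] and has
    length at most [c * |k|_T + 2 (c + 1)], while [x1], [x2] are at distance at
    least [|k|_S - 2 (c + 1)] ([lower_divergence_le]). With [|k|_S] a little larger
    than [n * r] this bounds the divergence by [c * dist], with a
    multiplicative constant that domination does not absorb. To remove it, take
    [k] realizing the lower distortion at a scale [c] times larger and cut its
    word into [c] pieces of length about [|k|_T / c]: one of the pieces is still
    long for [S] ([long_subword]), and it is used in place of [k].

    Inside the Cayley graph, distances are bounded below by extending functions
    on the group linearly along the edges: such an extension is 1-Lipschitz as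
    soon as it is so on edges ([pl_path_interpolate]). Length metrics are bounded
    above by curves parametrized by arc length ([arc_length_metric]). *)

(** * Word lengths and distances to subsets *)

Lemma min_natP (A : set nat) : A !=set0 ->
  A (min_nat A) /\ forall m, A m -> (min_nat A <= m)%N.
Proof.
move=> [n An]; rewrite /min_nat; case: xgetP => [m _ //|none].
have ex : exists k, `[< A k >] by exists n; exact/asboolP.
case: (ex_minnP ex) => m /asboolP Am le_m.
by case: (none m); split=> // k /asboolP /le_m.
Qed.

Section Words.
Variable G : groupType.
Implicit Types (A H K : set G) (S T w : seq G) (a g h x : G).

Definition letter S x : bool := (x \in S) || (x^-1%g \in S).

Lemma letterV S x : letter S x -> letter S x^-1%g.
Proof. by rewrite /letter invgK orbC. Qed.

Lemma word_value_nil : word_value ([::] : seq G) = 1%g.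
Proof. by rewrite /word_value big_nil. Qed.

Lemma word_value_cons x w : word_value (x :: w) = (x * word_value w)%g.
Proof. by rewrite /word_value big_cons. Qed.

Lemma word_value_cat w w' :
  word_value (w ++ w') = (word_value w * word_value w')%g.
Proof. by rewrite /word_value big_cat. Qed.

Lemma is_word_cons S x w : is_word S (x :: w) = letter S x && is_word S w.
Proof. by []. Qed.

Lemma is_word_cat S w w' : is_word S (w ++ w') = is_word S w && is_word S w'.
Proof. exact: all_cat. Qed.

Lemma generatesE S K g : generates S K ->
  K g <-> exists2 w, is_word S w & word_value w = g.
Proof. by move=> <-. Qed.

(** Besides the distance to [H] this covers, for a singleton, the word metric
    itself, so that both share their Lipschitz estimates. *)
Definition set_dist S A g : nat :=
  min_nat [set size w | w in [set w | is_word S w /\ A (g * word_value w)%g]].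

Lemma set_dist_le S A g w :
  is_word S w -> A (g * word_value w)%g -> (set_dist S A g <= size w)%N.
Proof. by move=> Sw Aw; apply: (min_natP _).2; [exists (size w)|]; exists w. Qed.

Lemma set_dist_word S A g : generates S [set: G] -> A !=set0 ->
  exists w, [/\ is_word S w, A (g * word_value w)%g & size w = set_dist S A g].
Proof.
move=> genS [a Aa].
have [w Sw wE] := (generatesE (g^-1 * a)%g genS).1 I.
have [[v [Sv Av] vE] _] : let B :=
    [set size w | w in [set w | is_word S w /\ A (g * word_value w)%g]] in
    B (min_nat B) /\ forall m, B m -> (min_nat B <= m)%N.
  by apply: min_natP; exists (size w), w => //; split=> //; rewrite wE mulVKg.
by exists v.
Qed.

Lemma set_dist_in S A g : A g -> set_dist S A g = 0%N.
Proof.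
move=> Ag; apply/eqP; rewrite -leqn0.
by apply: (@set_dist_le S A g [::]); rewrite // word_value_nil mulg1.
Qed.

Lemma set_dist0 S A g : generates S [set: G] -> A !=set0 ->
  set_dist S A g = 0%N -> A g.
Proof.
move=> genS A0 d0; have [w [_ + /eqP]] := set_dist_word g genS A0.
by rewrite d0 size_eq0 => + /eqP wE; rewrite wE word_value_nil mulg1.
Qed.

Lemma set_dist_letterV S A g x : generates S [set: G] -> A !=set0 ->
  letter S x -> (set_dist S A g <= (set_dist S A (g * x)%g).+1)%N.
Proof.
move=> genS A0 Sx; have [w [Sw Aw <-]] := set_dist_word (g * x)%g genS A0.
apply: (@set_dist_le S A g (x :: w)); first by rewrite is_word_cons Sx.
by rewrite word_value_cons mulgA.
Qed.

Lemma set_dist_letter S A g x : generates S [set: G] -> A !=set0 ->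
  letter S x -> (set_dist S A (g * x)%g <= (set_dist S A g).+1)%N.
Proof.
move=> genS A0 /letterV Sx.
by rewrite -{2}[g](mulgK x); apply: set_dist_letterV.
Qed.

(** The first letter of a shortest word from [g] to [A] brings [g] one step
    closer. *)
Lemma set_dist_descend S A g m : generates S [set: G] -> A !=set0 ->
  set_dist S A g = m.+1 -> exists x, letter S x /\ set_dist S A (g * x)%g = m.
Proof.
move=> genS A0 dg; have [w [+ + +]] := set_dist_word g genS A0; rewrite dg.
case: w => // x w; rewrite is_word_cons => /andP[Sx Sw].
rewrite word_value_cons mulgA => Aw [wm]; exists x; split => //.
apply/eqP; rewrite eqn_leq -{1}wm set_dist_le //=.
have := set_dist_letterV g genS A0 Sx; rewrite dg.
by rewrite ltnS.
Qed.

Lemma set_dist1 S a g : set_dist S [set a] g = word_length S (g^-1 * a)%g.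
Proof.
congr (min_nat [set size w | w in _]); apply/seteqP; split=> w /= [Sw wE]; split=> //.
  by rewrite -wE mulKg.
by rewrite wE mulVKg.
Qed.

Lemma word_lengthE S g : word_length S g = set_dist S [set g] 1%g.
Proof. by rewrite set_dist1 invg1 mul1g. Qed.

Lemma word_length_le S w : is_word S w -> (word_length S (word_value w) <= size w)%N.
Proof. by move=> Sw; rewrite word_lengthE; apply: set_dist_le; rewrite //= mul1g. Qed.

Lemma word_length_word S K g : generates S K -> K g ->
  exists w, [/\ is_word S w, word_value w = g & size w = word_length S g].
Proof.
move=> genS /(generatesE g genS)[w Sw wE].
have [[v [Sv vE] vs] _] : let B :=
    [set size w | w in [set w | is_word S w /\ word_value w = g]] in
    B (min_nat B) /\ forall m, B m -> (min_nat B <= m)%N.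
  by apply: min_natP; exists (size w), w.
by exists v.
Qed.

Lemma word_lengthM S g h : generates S [set: G] ->
  (word_length S (g * h)%g <= word_length S g + word_length S h)%N.
Proof.
move=> genS; have [v [Sv <- <-]] := word_length_word (g := g) genS I.
have [w [Sw <- <-]] := word_length_word (g := h) genS I.
by rewrite -size_cat -word_value_cat word_length_le // is_word_cat Sv.
Qed.

Lemma word_length1 S : word_length S (1%g : G) = 0%N.
Proof. by rewrite word_lengthE set_dist_in. Qed.

Lemma letter_length_bound S T :
  exists2 c, (0 < c)%N & forall x, letter T x -> (word_length S x <= c)%N.
Proof.
exists (\max_(x <- T ++ [seq x^-1%g | x <- T]) word_length S x).+1 => // x Tx.
apply/leqW/(@leq_bigmax_seq _ _ predT) => //; rewrite mem_cat.
by case/orP: Tx => [->//|Tx]; rewrite -[x]invgK map_f ?orbT.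
Qed.

Lemma word_length_change S T c w : generates S [set: G] ->
  (forall x, letter T x -> (word_length S x <= c)%N) -> is_word T w ->
  (word_length S (word_value w) <= c * size w)%N.
Proof.
move=> genS Tc; elim: w => [|x w IHw]; first by rewrite word_value_nil word_length1.
rewrite is_word_cons => /andP[Tx Tw]; rewrite word_value_cons mulnS.
by rewrite (leq_trans (word_lengthM _ _ genS)) // leq_add ?Tc ?IHw.
Qed.

(** Pigeonhole: if each of the [c] consecutive pieces of [w] of size [p] had
    length at most [q], the product would have length at most [c * q]. *)
Lemma long_subword S T p q c w : generates S [set: G] -> is_word T w ->
  (size w <= c * p)%N -> (c * q < word_length S (word_value w))%N ->
  exists v, [/\ is_word T v, (size v <= p)%N & (q < word_length S (word_value v))%N].
Proof.
move=> genS; elim: c w => [|c IHc] w Tw.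
  by rewrite leqn0 size_eq0 => /eqP->; rewrite word_value_nil word_length1.
move=> wp wq; have Tcat := Tw; rewrite -(cat_take_drop p w) is_word_cat in Tcat.
case/andP: Tcat => Tt Td.
have [long|short] := ltnP q (word_length S (word_value (take p w))).
  by exists (take p w); rewrite size_take_min geq_minl.
apply: IHc Td _ _; first by rewrite size_drop leq_subLR -mulSn.
move: wq; rewrite -{1}(cat_take_drop p w) word_value_cat => /leq_trans.
move=> /(_ _ (word_lengthM _ _ genS)); rewrite mulSn; lia.
Qed.

Lemma finite_words S N : finite_set [set w | is_word S w /\ (size w < N)%N].
Proof.
elim: N => [|N IHN]; first by apply: sub_finite_set (finite_set0 _) => w [].
pose L := S ++ [seq x^-1%g | x <- S].
apply: (@sub_finite_set _ _ ([set [::]] `|`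
  ((fun p : G * seq G => p.1 :: p.2) @`
    ([set` L] `*` [set w | is_word S w /\ (size w < N)%N])))); last first.
  by rewrite finite_setU; split; [exact: finite_set1|apply/finite_image/finite_setX].
move=> [|x w]; first by left.
case; rewrite is_word_cons => /andP[Sx Sw] wN; right; exists (x, w) => //=.
split=> //=; rewrite mem_cat.
by case/orP: Sx => [->//|Sx]; rewrite -[x]invgK map_f ?orbT.
Qed.

Lemma word_length_unbounded S K N : generates S [set: G] -> infinite_set K ->
  exists2 k, K k & (N <= word_length S k)%N.
Proof.
move=> genS Kinf; apply: contrapT => small; apply: Kinf.
apply: sub_finite_set (finite_image (@word_value G) (finite_words S N)) => k Kk.
have [w [Sw wE sw]] := word_length_word (g := k) genS I.
exists w => //=; split=> //; rewrite sw ltnNge.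
by apply/negP => Nk; apply: small; exists k.
Qed.

End Words.

(** * Distances to a normal subgroup *)

Section NormalSubgroup.
Variables (G : groupType) (S : seq G) (H : set G).
Hypotheses (genS : generates S [set: G]) (normalH : normal_subgroup H).
Implicit Types g h : G.

Let H1 : H 1%g.
Proof. by case: normalH => -[]; rewrite inE. Qed.

Let HV h : H h -> H h^-1%g.
Proof. by case: normalH => /group_closedV HV _ /mem_set/HV; rewrite inE. Qed.

Let HM g h : H g -> H h -> H (g * h)%g.
Proof.
case: normalH => /group_closedM HM _ /mem_set Hg /mem_set Hh.
by have := HM _ _ Hg Hh; rewrite inE.
Qed.

(** Left translation by [H] is an isometry preserving [H], and [g * h] is the
    left translate of [g] by [g * h * g^-1]. *)
Lemma set_dist_mulr g h : H h -> set_dist S H (g * h)%g = set_dist S H g.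
Proof.
move=> Hh; have Hc : H (g * h * g^-1)%g.
  by have := normalH.2 h g^-1%g Hh; rewrite conjgE invgK mulgA.
congr (min_nat [set size w | w in _]); apply/seteqP; split=> w /= [Sw Hw]; split=> //.
  have := HM (HV Hc) Hw.
  by rewrite !invgM invgK -!mulgA mulKg mulKg.
have := HM Hc Hw; by rewrite -!mulgA mulKg.
Qed.

(** A ball of the word metric meets finitely many cosets of [H]. *)
Lemma set_dist_unbounded N : infinite_index H -> exists g, (N <= set_dist S H g)%N.
Proof.
move=> Hinf; apply: contrapT => small; apply: Hinf.
apply: sub_finite_set (finite_image
  (fun w => left_coset (word_value w)^-1%g H) (finite_words S N)).
move=> _ [g _ <-]; have [w [Sw Hw sw]] := set_dist_word g genS (ex_intro _ _ H1).
exists w; first split=> //.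
  by rewrite sw ltnNge; apply/negP => Ng; apply: small; exists g.
set v := word_value w in Hw *.
(* conjugating g * v by v gives v * g in H, so g and v^-1 are in one coset *)
have Hu : H (v * g)%g by have := normalH.2 _ v^-1%g Hw; rewrite conjgE invgK mulgK.
apply/seteqP; split=> _ [h Hh <-].
  by exists ((v * g)^-1 * h)%g; [exact: HM (HV Hu) _|rewrite invgM !mulgA mulgV mul1g].
by exists (v * g * h)%g; [exact: HM|rewrite !mulgA mulVg mul1g].
Qed.

End NormalSubgroup.

(** * Paths and distances in the Cayley graph *)

Section CayleyGraph.
Variables (R : realType) (G : groupType) (S : seq G).
Local Open Scope ring_scope.
Local Notation point := (cayley_point R S).
Implicit Types (x y z : point) (f : G -> R) (g : G) (l r t : R) (P : set point).

Lemma pl_path_trans x y z l l' :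
  pl_path x y l -> pl_path y z l' -> pl_path x z (l + l').
Proof.
elim=> [w|g s a b w k aI bI _ IH] yz; first by rewrite add0r.
by rewrite -addrA; apply: pl_step => //; exact: IH.
Qed.

Lemma pl_path_edge g (s : seq_sub S) (a b : R) : 0 <= a <= 1 -> 0 <= b <= 1 ->
  pl_path (edge_point g s a) (edge_point g s b) `|a - b|.
Proof.
by move=> aI bI; rewrite -[X in pl_path _ _ X]addr0; apply: pl_step => //; constructor.
Qed.

Lemma pl_path_sym x y l : pl_path x y l -> pl_path y x l.
Proof.
elim=> [w|g s a b w k aI bI _ IH]; first by constructor.
by rewrite addrC distrC; apply: pl_path_trans IH _; exact: pl_path_edge.
Qed.

Lemma cayley_dist_le x y l : pl_path x y l -> (cayley_dist x y <= l%:E)%E.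
Proof. by move=> xy; apply: ereal_inf_lbound; exists l. Qed.

Definition interpolate f x : R :=
  match x with
  | Vertex g => f g
  | Inner g s t => (1 - val t) * f g + val t * f (g * val s)%g
  end.

Lemma interpolate_edge f g (s : seq_sub S) t : 0 <= t <= 1 ->
  interpolate f (edge_point g s t) = (1 - t) * f g + t * f (g * val s)%g.
Proof.
rewrite /edge_point => /andP[t0 t1]; case: insubP => [u _ <- //|out].
case: ifPn => [t'0|t'0] /=.
  have -> : t = 0 by lra.
  by rewrite subr0 mul1r mul0r addr0.
have -> : t = 1.
  apply/eqP; rewrite eq_le t1 leNgt; apply/negP => t'1; case/negP: out.
  by rewrite t'1 ltNge t'0.
by rewrite subrr mul0r mul1r add0r.
Qed.

Definition edge_contracting f : Prop :=
  forall g s, s \in S -> `|f (g * s)%g - f g| <= 1.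

(** An affine function on a unit interval is as contracting as its values at the
    two ends tell, and lengths of pieces add up. *)
Lemma pl_path_interpolate f x y l : edge_contracting f -> pl_path x y l ->
  `|interpolate f x - interpolate f y| <= l.
Proof.
move=> f1; elim=> [w|g s a b w k aI bI _ IH]; first by rewrite subrr normr0.
apply: le_trans (ler_distD (interpolate f (edge_point g s b)) _ _) _.
apply: lerD IH; rewrite !interpolate_edge //.
have -> : (1 - a) * f g + a * f (g * val s)%g -
    ((1 - b) * f g + b * f (g * val s)%g) = (a - b) * (f (g * val s)%g - f g).
  by ring.
by rewrite normrM ler_piMr // f1 // ssvalP.
Qed.

Lemma interpolate_le_dist f x y l : edge_contracting f ->
  l <= `|interpolate f x - interpolate f y| -> (l%:E <= cayley_dist x y)%E.
Proof.
move=> f1 lf; apply: le_ereal_inf_tmp => _ [k xy <-]; rewrite lee_fin.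
exact: le_trans lf (pl_path_interpolate f1 xy).
Qed.

(** The edges of the graph carry an orientation and are labelled by [S] only;
    this parametrizes the edge of an inverse letter backwards, so that words can
    be followed without distinguishing the two kinds of letters. *)
Lemma letter_edge g (a : G) : letter S a -> exists e : R -> point,
  [/\ e 0 = Vertex R S g, e 1 = Vertex R S (g * a)%g,
      forall s t, 0 <= s <= 1 -> 0 <= t <= 1 -> pl_path (e s) (e t) `|s - t| &
      forall f t, 0 <= t <= 1 ->
        interpolate f (e t) = (1 - t) * f g + t * f (g * a)%g].
Proof.
have in01 (u : R) : u <= 0 \/ 1 <= u -> insub u = None :> option (open_unit R).
  by move=> out; apply: insubF; apply/negP => /andP[u0 u1]; lra.
case/orP=> Sa.
  exists (edge_point g (SeqSub Sa)); split=> [||s t|f t].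
  - by rewrite /edge_point in01 ?lexx //; left.
  - by rewrite /edge_point in01 ?ler10 //; right.
  - exact: pl_path_edge.
  - exact: interpolate_edge.
exists (fun t => edge_point (g * a)%g (SeqSub Sa) (1 - t)); split=> [||s t sI tI|f t tI].
- by rewrite /edge_point subr0 in01 ?ler10 /= ?mulgK //; right.
- by rewrite /edge_point subrr in01 ?lexx //; left.
- have -> : `|s - t| = `|(1 - s) - (1 - t)| by rewrite distrC; congr `| _ |; ring.
  by apply: pl_path_edge; lra.
- by rewrite interpolate_edge /= ?mulgK; [ring|lra].
Qed.

(** Curves parametrized by arc length on [[0, l]] inside [P]. Asking for a
    piecewise linear path of length [t - s] between the times [s] and [t] makes
    the curve 1-Lipschitz by definition, and is stable under concatenation. *)
Definition unit_speed_arc P x y l : Prop := exists c : R -> point,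
  [/\ 0 <= l, c 0 = x, c l = y, (forall t, 0 <= t <= l -> P (c t)) &
      forall s t, 0 <= s -> s <= t -> t <= l -> pl_path (c s) (c t) (t - s)].

Lemma arc_refl P x : P x -> unit_speed_arc P x x 0.
Proof.
exists (fun=> x); split=> // s t s0 st t0.
have -> : t - s = 0 by lra.
by constructor.
Qed.

Lemma arc_pl_path P x y l : unit_speed_arc P x y l -> pl_path x y l.
Proof.
by move=> [c [l0 <- <- _ cpl]]; have := cpl 0 l (lexx _) l0 (lexx _); rewrite subr0.
Qed.

Lemma arc_sym P x y l : unit_speed_arc P x y l -> unit_speed_arc P y x l.
Proof.
move=> [c [l0 c0 cl cP cpl]]; exists (fun t => c (l - t)); split => //.
- by rewrite subr0.
- by rewrite subrr.
- by move=> t tI; apply: cP; lra.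
move=> s t s0 st tl; apply: pl_path_sym.
have -> : t - s = (l - s) - (l - t) by ring.
by apply: cpl; lra.
Qed.

Lemma arc_cat P x y z l l' :
  unit_speed_arc P x y l -> unit_speed_arc P y z l' -> unit_speed_arc P x z (l + l').
Proof.
move=> [c [l0 c0 cl cP cpl]] [d [l'0 d0 dl' dP dpl]].
exists (fun t => if t <= l then c t else d (t - l)); split.
- exact: addr_ge0.
- by rewrite l0.
- case: ifPn => [le|_]; last by rewrite addrAC subrr add0r.
  have l'E : l' = 0 by lra.
  by rewrite l'E addr0 cl -d0 -l'E.
- move=> t tI; case: ifPn => [le|]; first by apply: cP; lra.
  by rewrite -ltNge => lt; apply: dP; lra.
move=> s t s0 st tl; case: ifPn => [sl|]; case: ifPn => [t'l|].
- exact: cpl.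
- rewrite -ltNge => lt; have -> : t - s = (l - s) + (t - l - 0) by ring.
  by apply: pl_path_trans (dpl _ _ _ _ _); rewrite ?d0 -?cl; try apply: cpl; lra.
- by rewrite -ltNge => lt; lra.
- rewrite -!ltNge => lt lt'; have -> : t - s = (t - l) - (s - l) by ring.
  by apply: dpl; lra.
Qed.

(** For a 1-Lipschitz curve the sums defining the length telescope. *)
Lemma subdivision_sum_le (c : R -> point) l (u : R) (s : seq R) : 0 <= u -> 0 <= l ->
  (forall s t, 0 <= s -> s <= t -> t <= l -> pl_path (c s) (c t) (t - s)) ->
  path <%O u s -> last u s <= 1 ->
  (\sum_(0 <= i < size s) cayley_dist (c (l * nth 1 (u :: s) i)%R)
     (c (l * nth 1 (u :: s) i.+1)%R) <= (l * (last u s - u))%R%:E)%E.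
Proof.
move=> u0 l0 cpl; elim: s u u0 => [|v s IHs] u u0 /=.
  by rewrite big_geq // subrr mulr0.
move=> /andP[uv vs] s1; rewrite big_nat_recl //=.
have vlast : v <= last v s.
  elim: (s) (v) vs => //= w t IHt v' /andP[v'w /IHt]; exact: le_trans (ltW v'w).
have -> : l * (last v s - u) = (l * v - l * u) + l * (last v s - v) by ring.
rewrite EFinD; apply: leeD.
  apply/cayley_dist_le/cpl; nra.
by apply: IHs => //; apply: le_trans u0 (ltW uv).
Qed.

(** The curve is run at constant speed [l] on [[0, 1]]; it is then
    [l]-Lipschitz, whence continuity (with modulus [e / (l + 1)], as [l] may be
    [0]) and the bound on its length. *)
Lemma arc_length_metric P (C : set point) x y l : P `<=` C ->
  unit_speed_arc P x y l -> (length_metric (@cayley_dist R G S) C x y <= l%:E)%E.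
Proof.
move=> PC [c [l0 c0 cl cP cpl]].
apply: (@le_trans _ _ (curve_length (@cayley_dist R G S) (fun t => c (l * t)))).
  apply: ereal_inf_lbound; exists (fun t => c (l * t)) => //; split.
  - move=> t e tI e0; exists (e / (l + 1)); first by rewrite divr_gt0 //; lra.
    move=> u uI; rewrite ltr_pdivlMr; last by lra.
    move=> ut; apply: (@le_lt_trans _ _ (l * `|u - t|)%:E); last first.
      by rewrite lte_fin; have := normr_ge0 (u - t); nra.
    apply: cayley_dist_le; case: (leP t u) => tu.
      by rewrite ger0_norm ?subr_ge0 // mulrBr; apply: cpl; nra.
    rewrite distrC ger0_norm ?subr_ge0 ?ltW // mulrBr.
    by apply: pl_path_sym; apply: cpl; nra.
  - by rewrite mulr0.
  - by rewrite mulr1.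
  - by move=> t tI; apply/PC/cP; nra.
apply: ge_ereal_sup => _ [s [s_path /eqP s_last] <-].
apply: le_trans (subdivision_sum_le (lexx 0) l0 cpl s_path _) _; rewrite s_last //.
by rewrite subr0 mulr1.
Qed.

End CayleyGraph.

(** * Height above a subset *)

Section Height.
Variables (R : realType) (G : groupType) (S : seq G) (A : set G).
Hypotheses (genS : generates S [set: G]) (A0 : A !=set0).
Local Open Scope ring_scope.
Local Notation point := (cayley_point R S).
Implicit Types (x y : point) (g : G) (r l t : R).

Definition real_dist g : R := (set_dist S A g)%:R.

(** A lower bound of the distance to [A], strict inside an edge whose ends are
    equally far from [A]; this is the side needed to stay away from [A]. *)
Definition height x : R := interpolate real_dist x.

Definition outside r : set point := [set x | r <= height x].

Lemma real_dist_letter g a : letter S a ->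
  real_dist (g * a)%g <= real_dist g + 1 /\ real_dist g <= real_dist (g * a)%g + 1.
Proof.
by move=> Sa; rewrite !natr1 !ler_nat set_dist_letter ?set_dist_letterV.
Qed.

Lemma edge_contracting_dist : edge_contracting S real_dist.
Proof.
move=> g s Ss; have [|up down] := @real_dist_letter g s; first by rewrite /letter Ss.
by rewrite ler_norml; lra.
Qed.

Lemma height_le_dist x : ((height x)%:E <= dist_to_subgroup A x)%E.
Proof.
apply: le_ereal_inf_tmp => _ [_ [a Aa <-] <-].
apply: (interpolate_le_dist edge_contracting_dist); rewrite /= {2}/real_dist.
by rewrite set_dist_in // subr0 ler_norm.
Qed.

Lemma outside_nbhd_compl r r' : r' <= r -> outside r `<=` nbhd_compl A r'.
Proof.
move=> r'r x; rewrite /outside /nbhd_compl /nbhd /= => rx.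
by move=> /(le_lt_trans (height_le_dist x)); rewrite lte_fin => xr'; lra.
Qed.

Lemma edge_arc (P : set point) (e : R -> point) t : 0 <= t <= 1 ->
  (forall s t, 0 <= s <= 1 -> 0 <= t <= 1 -> pl_path (e s) (e t) `|s - t|) ->
  (forall s, t <= s <= 1 -> P (e s)) -> unit_speed_arc P (e t) (e 1) (1 - t).
Proof.
move=> tI epl eP; exists (fun s => e (t + s)); split.
- lra.
- by rewrite addr0.
- by rewrite addrC subrK.
- by move=> s sI; apply: eP; lra.
move=> u v u0 uv v1; have -> : v - u = `|(t + u) - (t + v)|.
  by rewrite distrC ger0_norm; lra.
by apply: epl; lra.
Qed.

(** Height is affine along an edge, so it is controlled by the ends. *)
Lemma letter_arc r g a : letter S a ->
  r <= real_dist g -> r <= real_dist (g * a)%g ->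
  unit_speed_arc (outside r) (Vertex R S g) (Vertex R S (g * a)%g) 1.
Proof.
move=> Sa rg rga; have [e [e0 e1 epl eint]] := @letter_edge R G S g a Sa.
rewrite -e0 -e1 -[X in unit_speed_arc _ _ _ X]subr0; apply: edge_arc => //; first lra.
by move=> s sI; rewrite /outside /= /height eint //; nra.
Qed.

Lemma word_arc r g w : is_word S w -> r + (size w)%:R <= real_dist g ->
  unit_speed_arc (outside r)
    (Vertex R S g) (Vertex R S (g * word_value w)%g) (size w)%:R.
Proof.
elim: w g => [|a w IHw] g.
  by rewrite word_value_nil mulg1 addr0 => _ rg; apply: arc_refl.
rewrite is_word_cons => /andP[Sa Sw] /=; rewrite -natr1 => rg.
have [up down] := real_dist_letter g Sa; have w0 : 0 <= (size w)%:R :> R by [].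
rewrite addrC word_value_cons mulgA; apply: arc_cat (IHw _ Sw _); last by lra.
by apply: letter_arc => //; lra.
Qed.

(** A geodesic from [A] to [g], cut at height [r]: induction on the distance
    from [g] to [A], the cut being on the last edge exactly when [r] exceeds the
    distance from the previous vertex. *)
Lemma radial_arc r g : 0 <= r <= real_dist g -> exists x,
  [/\ height x = r,
      unit_speed_arc (outside r) x (Vertex R S g) (real_dist g - r) &
      exists2 a, A a & pl_path x (Vertex R S a) r].
Proof.
rewrite /real_dist; move: {2}(set_dist S A g) (erefl (set_dist S A g)) => m.
elim: m g r => [|m IHm] g r dg; rewrite dg.
  move=> rI; have -> : r = 0 by lra.
  have h0 : height (Vertex R S g) = 0 by rewrite /height /= /real_dist dg.
  exists (Vertex R S g); split=> //; last by exists g; [exact: set_dist0 dg|constructor].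
  by rewrite subrr; apply: arc_refl; rewrite /outside /mkset h0.
move=> rI; have [a [Sa dga]] := set_dist_descend genS A0 dg.
have Sb := letterV Sa; set b := a^-1%g in Sb.
have gE : g = (g * a * b)%g by rewrite mulgK.
have m1E : m.+1%:R = m%:R + 1 :> R by rewrite natr1.
case: (leP r m%:R) => rm.
  have [|x [xr xarc xA]] := IHm _ r dga; first by rewrite dga; lra.
  exists x; split=> //; rewrite dga in xarc; have -> : m.+1%:R - r = m%:R - r + 1 by lra.
  apply: arc_cat xarc _; have := @letter_arc r (g * a)%g b Sb; rewrite -gE.
  by apply; rewrite /real_dist ?dga ?dg; lra.
(* at height m the arc to the vertex g * a has length 0, whence a path down to A *)
have [|x [xr xarc [h Ah xh]]] := IHm _ m%:R dga; first by rewrite dga ler0n lexx.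
have [e [e0 e1 epl eint]] := @letter_edge R G S (g * a)%g b Sb.
have eh t : 0 <= t <= 1 -> height (e t) = m%:R + t.
  by move=> tI; rewrite /height eint // -gE /real_dist dg dga m1E; ring.
exists (e (r - m%:R)); split.
- by rewrite eh; lra.
- rewrite -gE in e1; rewrite -e1.
  have -> : m.+1%:R - r = 1 - (r - m%:R) by lra.
  by apply: edge_arc => //; [lra|move=> s sI; rewrite /outside /= eh; lra].
exists h => //.
have rE : r = `|(r - m%:R) - 0| + m%:R by rewrite subr0 ger0_norm; lra.
rewrite [X in pl_path _ _ X]rE; apply: pl_path_trans; first by apply: epl; lra.
rewrite e0.
rewrite -[m%:R]add0r; apply: pl_path_trans xh; apply: pl_path_sym.
by move: xarc => /arc_pl_path; rewrite dga subrr.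
Qed.

End Height.

(** * Upper bounds for the divergence *)

Section Divergence.
Variables (R : realType) (G : groupType) (S T : seq G) (H : set G).
Hypotheses (genS : generates S [set: G]) (normalH : normal_subgroup H).
Hypotheses (indexH : infinite_index H) (TH : forall t, letter T t -> H t).
Local Open Scope ring_scope.
Implicit Types (g : G) (r : R) (v : seq G) (c : nat).

Let H0 : H !=set0.
Proof. by exists 1%g; case: normalH => -[]; rewrite inE. Qed.

Lemma set_dist_attained m : exists g, set_dist S H g = m.
Proof.
have [g] := set_dist_unbounded genS normalH m indexH.
move=> /subnK; move: (_ - m)%N => j; elim: j g => [|j IHj] g dg; first by exists g.
by have [a [_ /esym/IHj]] := set_dist_descend genS H0 (esym dg).
Qed.

(** The letters of [T] lie in [H], so the vertices [g * k] reached after each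
    of them are as far from [H] as [g]; the word in [S] replacing a letter has
    size at most [c], so its path stays at height at least [r]. *)
Lemma coset_arc r c g v :
  (forall t, letter T t -> (word_length S t <= c)%N) -> is_word T v ->
  r + c%:R <= real_dist R S H g ->
  exists2 l : R, l <= (c * size v)%:R & unit_speed_arc (outside H r)
    (Vertex R S g) (Vertex R S (g * word_value v)%g) l.
Proof.
move=> Tc; elim: v g => [|t v IHv] g.
  move=> _ rg; rewrite word_value_nil mulg1; exists 0 => //; apply: arc_refl.
  by rewrite /outside /=; have : 0 <= c%:R :> R by []; rewrite /height /=; lra.
rewrite is_word_cons => /andP[Tt Tv] rg.
have [w [Sw wE ws]] := word_length_word (g := t) genS I.
have wc : (size w)%:R <= c%:R :> R by rewrite ler_nat ws Tc.
have [|l lv larc] := IHv (g * t)%g Tv.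
  by rewrite /real_dist (set_dist_mulr S normalH) //; exact: TH.
exists ((size w)%:R + l); first by rewrite mulnS natrD lerD.
rewrite word_value_cons mulgA; apply: arc_cat larc.
by rewrite -wE; apply: word_arc => //; lra.
Qed.

(** Both ends of the path from [x1] over [g] and [g * k] to [x2] lie at distance
    at most [c + 1] from [g] and [g * k]; this is the origin of [2 * (c + 1)] in
    both the length of the path and the loss in the distance of [x1] to [x2]. *)
Lemma lower_divergence_le (rho r : R) n c v :
  0 < rho <= 1 -> 0 < r ->
  (forall t, letter T t -> (word_length S t <= c)%N) -> is_word T v ->
  n%:R * r + 2 * (c%:R + 1) <= (word_length S (word_value v))%:R ->
  (lower_divergence S H rho n r <= (2 * (c%:R + 1) + (c * size v)%:R)%:E)%E.
Proof.
move=> rhoI r0 Tc Tv far; set k := word_value v in far.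
have Hk : H k.
  elim: v Tv @k {far} => [|t v IHv]; first by case: normalH => -[]; rewrite word_value_nil inE.
  rewrite is_word_cons => /andP[Tt /IHv /mem_set Hv] /=; rewrite word_value_cons.
  have [/group_closedM HM _] := normalH.
  by have := HM _ _ (mem_set (TH Tt)) Hv; rewrite inE.
have /andP[mr rm] := truncn_itv (ltW r0); rewrite -natr1 in rm.
have [g dg] := set_dist_attained ((Num.truncn r).+1 + c).
have c0 : 0 <= c%:R :> R by [].
have dgE : real_dist R S H g = (Num.truncn r)%:R + 1 + c%:R.
  by rewrite /real_dist dg natrD natr1.
have dgkE : real_dist R S H (g * k)%g = real_dist R S H g.
  by rewrite /real_dist (set_dist_mulr S normalH).
have [|x1 [x1r arc1 [h1 Hh1 down1]]] := radial_arc genS H0 (r := r) (g := g).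
  by rewrite dgE; lra.
have [|x2 [x2r arc2 [h2 Hh2 down2]]] := radial_arc genS H0 (r := r) (g := (g * k)%g).
  by rewrite dgkE dgE; lra.
rewrite dgkE in arc2.
have [|l lv arck] := coset_arc (r := r) Tc Tv (g := g); first by rewrite dgE; lra.
have arc12 := arc_cat arc1 (arc_cat arck (arc_sym arc2)).
have on_boundary x h : H h -> height H x = r -> pl_path x (Vertex R S h) r ->
    nbhd_boundary H r x.
  move=> Hh xr xh; apply/eqP; rewrite eq_le -{2}xr height_le_dist // andbT.
  apply: le_trans (cayley_dist_le xh).
  by apply: ereal_inf_lbound; exists (Vertex R S h) => //; exists h.
have dist12 r' : r' <= r -> (compl_dist H r' x1 x2 <=
    (real_dist R S H g - r + (l + (real_dist R S H g - r)))%:E)%E.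
  by move=> r'r; apply: arc_length_metric arc12; exact: outside_nbhd_compl.
apply: (@le_trans _ _ (compl_dist H (rho * r) x1 x2)); last first.
  apply: (le_trans (dist12 _ _)); first by nra.
  by rewrite lee_fin dgE; lra.
apply: ereal_inf_lbound; exists (x1, x2) => //=; split.
- exact: on_boundary x1r down1.
- exact: on_boundary x2r down2.
- by apply: le_lt_trans (dist12 r (lexx _)) _; rewrite ltry.
(* the distance to the vertex g * k separates x1 from x2 *)
have contr := edge_contracting_dist R (A := [set (g * k)%g]) genS (ex_intro _ _ erefl).
apply: (interpolate_le_dist contr).
have := pl_path_interpolate contr (arc_pl_path arc2).
have := pl_path_interpolate contr (arc_pl_path arc1).
have -> : interpolate (real_dist R S [set (g * k)%g]) (Vertex R S g) =
    (word_length S k)%:R by rewrite /= /real_dist set_dist1 mulKg.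
have -> : interpolate (real_dist R S [set (g * k)%g]) (Vertex R S (g * k)%g) = 0.
  by rewrite /= /real_dist set_dist_in.
rewrite !ler_norml dgE => /andP[near1 _] /andP[_ near2].
rewrite ler_normr; apply/orP; left; lra.
Qed.

End Divergence.

(** * Comparison with the lower distortion *)

Section Distortion.
Variables (R : realType) (G : groupType) (S S' T : seq G) (H K : set G).
Hypotheses (genS : generates S [set: G]) (genS' : generates S' [set: G]).
Hypotheses (normalH : normal_subgroup H) (indexH : infinite_index H).
Hypotheses (KH : K `<=` H) (infiniteK : infinite_set K) (genT : generates T K).
Local Open Scope ring_scope.

(** The minimum is over a nonempty set, as [K] is infinite and balls are finite. *)
Lemma lower_distortionP (r : R) : exists w,
  [/\ is_word T w, lower_distortion S' T K r = (size w)%:R%:E &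
      r <= (word_length S' (word_value w))%:R].
Proof.
have [k Kk kr] := word_length_unbounded (Num.truncn `|r|).+1 genS' infiniteK.
pose B := [set word_length T k | k in [set k | K k /\ r <= (word_length S' k)%:R]].
have [|[k' [Kk' k'r] k'E] _] := @min_natP B.
  exists (word_length T k), k => //; split=> //.
  apply: (le_trans (ler_norm r)); apply: ltW.
  by have /andP[_ /lt_le_trans] := truncn_itv (normr_ge0 r); apply; rewrite ler_nat.
have [w [Tw wE ws]] := word_length_word genT Kk'.
by exists w; split=> //; [rewrite ws k'E|rewrite wE].
Qed.

Lemma divergence_dominated :
  family_dominated (@lower_divergence R G S H)
                   (const_family (@lower_distortion R G S' T K)).
Proof.
have TK t : letter T t -> K t.
  move=> Tt; apply/(generatesE t genT); exists [:: t]; first by rewrite is_word_cons Tt.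
  by rewrite word_value_cons word_value_nil mulg1.
have [c c0 Tc] := letter_length_bound S T.
have [c' c'0 Sc'] := letter_length_bound S' S.
have c1 : 1 <= c%:R :> R by rewrite ler1n.
have c'1 : 1 <= c'%:R :> R by rewrite ler1n.
exists 1, 1%N; split=> // [|rho n rhoI n2]; first by rewrite ltr01 lexx.
have n0 : 0 <= n%:R :> R by [].
(* c' compares the word lengths of S and S', c allows for the cutting into c pieces,
   and (n + 1) * r exceeds n * r + 2 * (c + 1) for r > 2 * (c + 1) *)
exists (c'%:R * (c%:R * (n%:R + 1))), 2, (2 * (c%:R + 1)); split=> [|||r rC].
- by rewrite !mulr_gt0 //; lra.
- by lra.
- by lra.
rewrite /const_family; have [w [Tw -> long]] := lower_distortionP (c'%:R * (c%:R * (n%:R + 1)) * r).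
have [w' [Sw' w'E w's]] := word_length_word (g := word_value w) genS I.
have wS : (word_length S' (word_value w) <= c' * word_length S (word_value w))%N.
  by rewrite -w's -w'E (word_length_change genS' Sc' Sw').
have {wS w' Sw' w'E w's} {}long : c%:R * ((n%:R + 1) * r) <=
    (word_length S (word_value w))%:R.
  move: wS; rewrite -(ler_nat R) natrM => /(le_trans long).
  by rewrite -!mulrA ler_pM2l ?ltr0n.
have d0 : 0 <= n%:R * r + 2 * (c%:R + 1) by nra.
have /andP[qd dq] := truncn_itv d0; set q := Num.truncn _ in qd dq.
have wp : (size w <= c * (size w %/ c).+1)%N by rewrite mulnC ltnW // ltn_ceil.
have [|v [Tv vp vq]] := @long_subword G S T _ q _ w genS Tw wp.
  by rewrite -(ltr_nat R) natrM; apply: lt_le_trans long; nra.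
rewrite mul1r; apply: le_trans.
  have TH t : letter T t -> H t by move=> /TK /KH.
  apply: (lower_divergence_le genS normalH indexH TH _ _ Tc Tv) => //.
  - by lra.
  - apply: ltW; apply: lt_le_trans dq _; by rewrite ler_nat.
have vw : (c * size v)%:R <= (size w)%:R + c%:R :> R.
  rewrite -natrD ler_nat (leq_trans (leq_mul (leqnn c) vp)) // mulnS addnC leq_add2r.
  by rewrite mulnC leq_divM.
by rewrite -EFinD lee_fin; lra.
Qed.

End Distortion.

Theorem theorem5p4 (R : realType) (G : groupType) (S S' : seq G) (H : set G)
    (genS : generates S [set: G]) (genS' : generates S' [set: G])
    (normalH : normal_subgroup H)
    (infiniteH : infinite_set H) (indexH : infinite_index H) :
  (forall (K : set G) (T : seq G),
     subgroup K -> K `<=` H -> infinite_set K -> generates T K ->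
     family_dominated (@lower_divergence R G S H)
                      (const_family (@lower_distortion R G S' T K))) /\
  (forall T : seq G, generates T H ->
     family_dominated (@lower_divergence R G S H)
                      (const_family (@lower_distortion R G S' T H))).
Proof.
split=> [K T _ KH infiniteK genT|T genT]; first exact: divergence_dominated.
by apply: divergence_dominated => //; exact: subset_refl.
Qed.
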